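(* Let $A=(a_{mn})_{m,n\ge0}$ be the infinite Gram matrix with entries $a_{mn}=\int_{\mathbb{R}}\psi_m(v)\psi_n(v)\,dv$. Then $A$ admits a unique Cholesky decomposition of the form $A=LDL^\top$ (with $L$ unit lower triangular and $D$ diagonal), where the entries of $L=(l_{nm})_{n,m\ge0}$ are given by $$l_{nm}=(-1)^{\frac{n-m}{2}}\sqrt{\frac{n!}{m!}}\;\frac{1}{4^{\frac{n-m}{2}}\left(\frac{n-m}{2}\right)!}\quad\text{if } n-m\in2\mathbb{N},\qquad l_{nm}=0\quad\text{otherwise},$$ and $D=\operatorname{diag}\left(2^{-m-\frac12}\right)_{m\ge0}$.
   Context: $\mathbb{N}$ contains $0$, so $2\mathbb{N}=\{0,2,4,\dots\}$. $T>0$ is fixed and $\psi_n(v)=\left(2^n n!\sqrt{\pi T}\right)^{-1/2}H_n\!\left(\frac{v}{\sqrt T}\right)e^{-v^2/T}$ for $n\in\mathbb{N}$, where $H_n$ is the (physicists') Hermite polynomial of degree $n$, with positive leading coefficient and $\int_{\mathbb{R}}H_nH_m e^{-v^2}\,dv=\sqrt{\pi}\,2^m m!\,\delta_{n,m}$. All matrices are infinite real matrices indexed by $\mathbb{N}\times\mathbb{N}$; each entry of the product $LDL^\top$ is a finite sum because $L$ is lower triangular. *)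

(* Defs.v *)
From HB Require Import structures.
From mathcomp Require Import all_boot all_order all_algebra.
From mathcomp Require Import all_classical all_reals all_analysis.
From mathcomp Require Import measurable_realfun ring lra.

Set Implicit Arguments.
Unset Strict Implicit.
Unset Printing Implicit Defensive.

Import Order.TTheory GRing.Theory Num.Theory.
Import numFieldNormedType.Exports.

Local Open Scope classical_set_scope.
Local Open Scope ring_scope.

(** Physicists' Hermite polynomials.  The recursion is one differentiation step
    of Rodrigues' formula [H_n(x) = (-1)^n e^(x^2) (d/dx)^n e^(-x^2)].  The
    lemmas [size_hermite], [lead_coef_hermite] and [hermite_orthogonal] below
    give the properties (degree [n], leading coefficient, orthogonality) that
    determine these polynomials. *)
Fixpoint hermite (R : nzRingType) (n : nat) : {poly R} :=
  if n is n'.+1 then 2 *: ('X * hermite R n') - (hermite R n')^`() else 1.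

Section HermiteDegree.
Variable R : numDomainType.

Lemma size_lead_hermite n :
  size (hermite R n) = n.+1 /\ lead_coef (hermite R n) = 2 ^+ n.
Proof.
elim: n => [|n [IHs IHl]]; first by rewrite /= size_poly1 lead_coef1.
have h0 : hermite R n != 0 by rewrite -size_poly_eq0 IHs.
have s1 : size (2 *: ('X * hermite R n)) = n.+2.
  rewrite size_scale ?pnatr_eq0//.
  by rewrite mulrC size_mulX // IHs.
have lt : (size (- (hermite R n)^`()) < size (2 *: ('X * hermite R n)))%N.
  by rewrite size_polyN s1 (leq_trans (lt_size_deriv h0))// IHs.
rewrite /= size_polyDl// lead_coefDl// s1; split => //.
by rewrite lead_coefZ ['X * _]mulrC lead_coefMX IHl exprS.
Qed.

Lemma size_hermite n : size (hermite R n) = n.+1.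
Proof. by case: (size_lead_hermite n). Qed.

Lemma lead_coef_hermite n : lead_coef (hermite R n) = 2 ^+ n.
Proof. by case: (size_lead_hermite n). Qed.

End HermiteDegree.

Section HermiteOrthogonal.
Variable R : realType.
Implicit Type p q : {poly R}.
Let mu := @lebesgue_measure R.

Let w (x : R) := expR (- x ^+ 2).

Let poly_bound p : exists K, forall x, `|p.[x]| <= K * expR (x ^+ 2 / 2).
Proof.
have [C [n [C0 Cp]]] : exists C n, 0 <= C /\
    forall x, `|p.[x]| <= C * (1 + x ^+ 2) ^+ n.
  elim/poly_ind: p => [|p c [C [n [C0 IH]]]].
    by exists 0, 0%N; split => // x; rewrite horner0 normr0 mul0r.
  exists (C + `|c|), n.+1; split => [|x]; first by rewrite addr_ge0.
  rewrite hornerMXaddC (le_trans (ler_normD _ _))// mulrDl lerD//.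
    rewrite normrM exprS mulrCA [leRHS]mulrC ler_pM//.
    have -> : x ^+ 2 = `|x| ^+ 2 by rewrite real_normK ?num_real.
    by set y := `|x|; nra.
  by rewrite ler_peMr// exprn_ege1// lerDl sqr_ge0.
exists (C * (n.+1`!%:R * 2 ^+ n.+1 * expR (2^-1))) => x.
rewrite (le_trans (Cp x))// -[leRHS]mulrA ler_wpM2l//.
have y1 : 1 <= 1 + x ^+ 2 by rewrite lerDl sqr_ge0.
rewrite (@le_trans _ _ ((1 + x ^+ 2) ^+ n.+1))//.
  by rewrite ler_weXn2l.
rewrite -[leRHS]mulrA -expRD (_ : 2^-1 + _ = (1 + x ^+ 2) / 2); last by field.
have y20 : 0 <= (1 + x ^+ 2) / 2 by rewrite divr_ge0// (le_trans ler01).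
have := expR_ge1Dxn n y20.
move=> le_e.
have {le_e} : ((1 + x ^+ 2) / 2) ^+ n.+1 / n.+1`!%:R <= expR ((1 + x ^+ 2) / 2).
  by rewrite (le_trans _ le_e)// lerDr.
rewrite ler_pdivrMr ?ltr0n ?fact_gt0// expr_div_n ler_pdivrMr ?exprn_gt0//.
by rewrite [expR _ * _]mulrC mulrAC.
Qed.

Let integrable_w2 : mu.-integrable setT (fun x : R => (expR (- (x ^+ 2 / 2)))%:E).
Proof.
have s1 : (1 : R) != 0 by [].
have k0 := normal_peak_gt0 s1.
have := integrableZl measurableT (normal_peak (1 : R))^-1
          (integrable_normal_pdf 0 (1 : R)).
apply: eq_integrable => // x _ /=.
rewrite -EFinM normal_pdfE// /normal_fun mulKf ?gt_eqF//.
by rewrite subr0 expr1n mulNr.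
Qed.

Let poly_w_bound p : exists K, forall x, `|p.[x] * w x| <= K * expR (- (x ^+ 2 / 2)).
Proof.
have [K Kp] := poly_bound p; exists K => x.
rewrite normrM (ger0_norm (expR_ge0 _)).
rewrite (le_trans (ler_wpM2r (expR_ge0 _) (Kp x)))//.
by rewrite -mulrA -expRD (_ : _ + _ = - (x ^+ 2 / 2))//; lra.
Qed.

Let continuous_w : continuous (fun x : R => w x).
Proof. exact: continuous_gauss_fun. Qed.

Let continuous_pw p : continuous (fun x => p.[x] * w x).
Proof.
by move=> x; apply: cvgM; [exact: continuous_horner|exact: continuous_w].
Qed.

Let measurable_pw p : measurable_fun setT (fun x => p.[x] * w x).
Proof. exact: continuous_measurable_fun. Qed.

Let integrable_pw p : mu.-integrable setT (fun x => (p.[x] * w x)%:E).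
Proof.
have [K Kp] := poly_w_bound p.
apply: (le_integrable _ _ _ (integrableZl measurableT K integrable_w2)) => //.
  by apply/measurable_EFinP; exact: measurable_pw.
by move=> x _ /=; rewrite lee_fin (le_trans (Kp x))// ler_norm.
Qed.

Let is_derive_pw p (x : R) :
  is_derive x (1 : R) (fun x => p.[x] * w x) ((p^`() - 2 *: ('X * p)).[x] * w x).
Proof.
have dw : is_derive x (1 : R) w (- (2 * x) * w x).
  rewrite /w; apply: trigger_derive; rewrite /GRing.scale/=; ring.
apply: (@trigger_derive _ _ _ (p.[x] *: (- (2 * x) * w x) + w x *: (p^`()).[x])).
rewrite !hornerE /GRing.scale/=; ring.
Qed.

Let J p := (\int[mu]_x (p.[x] * w x))%R.

Let J_deriv p : J (p^`() - 2 *: ('X * p)) = 0.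
Proof.
set q := p^`() - _.
pose F x := p.[x] * w x; pose f x := q.[x] * w x.
pose a (n : nat) : R := n.+1%:R.
pose I n := `[- a n, a n]%classic : set R.
have F'f x : (F^`()%classic) x = f x.
  by rewrite derive1E; have := is_derive_pw p x => /@derive_val.
have dF x : derivable F x 1 by have := is_derive_pw p x => /@ex_derive.
have IE n : (\int[mu]_(x in I n) (f x)%:E = (F (a n) - F (- a n))%:E)%E.
  rewrite (@continuous_FTC2 _ f F)//.
  - by rewrite -subr_gt0 opprK addr_gt0 ?ltr0n.
  - exact/continuous_subspaceT/continuous_pw.
  - split => [x _|//|//]; first exact: dF.
    + by apply: cvg_at_right_filter; exact: continuous_pw.
    + by apply: cvg_at_left_filter; exact: continuous_pw.
have F0 : F (a n) - F (- a n) @[n --> \oo] --> (0 : R).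
  have [K Kp] := poly_w_bound ('X * p).
  have FK x : `|x| * `|F x| <= K.
    have := Kp x; rewrite hornerM hornerX -mulrA normrM => /le_trans; apply.
    have K0 : 0 <= K.
      by have := Kp 0; rewrite expr0n mul0r oppr0 expR0 mulr1; exact: le_trans.
    rewrite ler_piMr// -[leRHS]expR0 ler_expR oppr_le0.
    by rewrite divr_ge0// sqr_ge0.
  apply/norm_cvg0P.
  apply: (@squeeze_cvgr _ _ _ _ (cst 0) (fun n => 2 * K * (a n)^-1)).
  - near=> n; rewrite normr_ge0/= (le_trans (ler_normB _ _))//.
    rewrite ler_pdivlMr ?ltr0n// mulrDl.
    have := FK (a n); have := FK (- a n).
    rewrite normrN (ger0_norm (ler0n _ _)).
    by rewrite -/(a n); lra.
  - exact: cvg_cst.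
  - rewrite -[X in _ --> X](mulr0 (2 * K)); apply: cvgMr.
    exact: cvg_harmonic.
have cvgI : (\int[mu]_x (((f \_ (I n)) x)%:E))%E @[n --> \oo] -->
    (\int[mu]_x (f x)%:E)%E.
  apply: (@dominated_cvg _ _ R mu setT measurableT
    (fun n x => ((f \_ (I n)) x)%:E) (EFin \o f) (fun x => `|f x|%:E)).
  - move=> n; apply/measurable_EFinP; have mI : measurable (I n) by exact: measurable_itv.
    by have [+ _] := measurable_restrictT f mI; apply; apply: measurable_funTS; exact: measurable_pw.
  - move=> x _; apply: cvg_near_cst.
    near=> n; rewrite /= patchT// inE /I /= in_itv/= -ler_norml.
    rewrite (@le_trans _ _ n%:R)//; last by rewrite /a ler_nat.
    by near: n; exact: nbhs_infty_ger.
  - by [].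
  - exact: integrable_norm (integrable_pw q).
  - move=> n x _ /=; rewrite lee_fin patchE; case: ifP => // _.
    by rewrite normr0.
have IE' n : (\int[mu]_x ((f \_ (I n)) x)%:E = (F (a n) - F (- a n))%:E)%E.
  rewrite -IE [RHS]integral_mkcond; apply: eq_integral => x _.
  by rewrite !patchE; case: ifP.
have cvg0 : (\int[mu]_x (((f \_ (I n)) x)%:E))%E @[n --> \oo] --> 0%:E.
  by under eq_fun do rewrite IE'; apply: cvg_EFin => //; exact: nearW.
rewrite /J /Rintegral -/f.
by rewrite (cvg_unique _ cvgI cvg0).
Unshelve. all: by end_near. Qed.

Let JB p q : J (p - q) = J p - J q.
Proof.
rewrite /J -RintegralB//; last 2 first.
- exact: integrable_pw.
- exact: integrable_pw.
by apply: eq_Rintegral => x _; rewrite hornerD hornerN mulrBl.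
Qed.

Let J_hermite n p : J (hermite R n * p) = J (p^`(n))%R.
Proof.
elim: n p => [|n IH] p; first by rewrite mul1r derivn0.
rewrite derivSn -IH [hermite _ _]/=.
set h := hermite R n.
apply/eqP; rewrite -subr_eq0 -JB.
have -> : (2 *: ('X * h) - h^`()) * p - h * p^`() =
  0 - ((h * p)^`() - 2 *: ('X * (h * p))).
  by rewrite derivM -!mul_polyC; ring.
rewrite JB J_deriv subr0 /J.
under eq_Rintegral do rewrite horner0 mul0r.
by rewrite /Rintegral integral0.
Qed.

Lemma hermite_orthogonal n m :
  (\int[lebesgue_measure]_v
     ((hermite R n).[v] * (hermite R m).[v] * expR (- v ^+ 2)))%R =
  if n == m then Num.sqrt pi * 2 ^+ m * m`!%:R else 0.
Proof.
have E k l : (\int[lebesgue_measure]_v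
     ((hermite R k).[v] * (hermite R l).[v] * expR (- v ^+ 2)))%R =
     J ((hermite R l)^`(k))%R.
  by rewrite -J_hermite; apply: eq_Rintegral => x _; rewrite hornerM.
have J0 : J 0 = 0 by have := JB 0 0; rewrite !subrr.
have lt0 k l : (l < k)%N -> J ((hermite R l)^`(k))%R = 0.
  by move=> lk; rewrite derivn_poly0 ?size_hermite.
case: (ltngtP n m) => [nm|mn|<-]; last 1 first.
- rewrite E; have -> : ((hermite R n)^`(n))%R = (2 ^+ n * n`!%:R)%:P.
    apply/polyP => i; rewrite coef_derivn coefC.
    case: i => [|i] /=.
      rewrite addn0 ffactnn -(lead_coef_hermite R n).
      by rewrite lead_coefE size_hermite mulr_natr.
    by rewrite nth_default ?mul0rn// size_hermite addnS ltnS leq_addr.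
  rewrite /J; under eq_Rintegral do rewrite hornerC.
  rewrite RintegralZl//; last exact: integrableT_gauss.
  by rewrite /Rintegral integralT_gauss/= mulrC mulrA.
- under eq_Rintegral do rewrite [X in X * _]mulrC.
  by rewrite E lt0.
- by rewrite E lt0.
Qed.

End HermiteOrthogonal.

Definition psi (R : realType) (T : R) (n : nat) (v : R) : R :=
  (2 ^+ n * n`!%:R * Num.sqrt (pi * T)) `^ (- 2^-1) *
  (hermite R n).[v / Num.sqrt T] * expR (- (v ^+ 2) / T).

Definition infmx (R : Type) := nat -> nat -> R.

Definition gram (R : realType) (f : nat -> R -> R) : infmx R :=
  fun m n => (\int[lebesgue_measure]_v (f m v * f n v))%R.

Section InfiniteMatrices.
Variable R : pzRingType.
Implicit Types A B L D : infmx R.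

(** [\sum_(k \in _) _] sums over the support, so this is the matrix product as
    soon as every entry involves only finitely many nonzero terms (e.g. when
    [A] is lower triangular); otherwise the entry has no meaning. *)
Definition infmx_mul A B : infmx R :=
  fun i j => \sum_(k \in [set: nat]) (A i k * B k j).

Definition infmx_tr A : infmx R := fun i j => A j i.

Definition infmx_diag (d : nat -> R) : infmx R :=
  fun i j => if i == j then d i else 0.

Definition is_infmx_diag D := forall i j, i != j -> D i j = 0.

Definition unit_lower L :=
  (forall i, L i i = 1) /\ (forall i j, (i < j)%N -> L i j = 0).

Definition is_LDL A L D :=
  [/\ unit_lower L, is_infmx_diag D &
      A = infmx_mul (infmx_mul L D) (infmx_tr L)].

End InfiniteMatrices.

Definition chol_L (R : realType) : infmx R := fun n m =>
  if (m <= n)%N && ~~ odd (n - m) then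
    (-1) ^+ (n - m)./2 * Num.sqrt (n`!%:R / m`!%:R) *
    (1 / (4 ^+ (n - m)./2 * (n - m)./2`!%:R))
  else 0.

Definition chol_D (R : realType) : infmx R :=
  infmx_diag (fun m => 2 `^ (- m%:R - 2^-1)).

(* Main.v *)
Require Import Defs.
From mathcomp Require Import all_boot all_order all_algebra.
From mathcomp Require Import all_classical all_reals all_analysis.
From mathcomp Require Import measurable_realfun ring lra zify.

Import Order.TTheory GRing.Theory Num.Theory.
Import numFieldNormedType.Exports.

Local Open Scope ring_scope.

(* The substitution [v = sqrt (T / 2) u] turns the Gram integrals into integrals
   of [H_m(u / sqrt 2) H_n(u / sqrt 2)] against [e^(-u^2)].  Since
   [H_n(u / sqrt 2) = 2^(-n/2) sum_k (-1)^k n! / (k! (n-2k)!) H_(n-2k)(u)],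
   orthogonality of the Hermite polynomials makes each entry a sum over the
   common index [j = n - 2k], which is the entry of [L D L^T].  Uniqueness holds
   for any [L D L^T] decomposition whose diagonal has no zero, column by column. *)

(** * Entries and uniqueness of infinite LDL decompositions *)

Lemma sum_nat_support (V : nmodType) (N : nat) (f : nat -> V) :
  (forall k, (N <= k)%N -> f k = 0) ->
  \sum_(k \in [set: nat]) f k = \sum_(k < N) f k.
Proof.
move=> f0; rewrite fsbig_ord; apply/esym/fsbig_widen => // k [_ /negP].
by rewrite -leqNgt => /f0.
Qed.

(** Row [i] of [L] vanishes past column [i], so every cut-off [N > i] captures the whole sum.
    Leaving [N] free allows a common range for two rows. *)
Lemma LDL_entry (R : pzRingType) (L D : infmx R) i j N :
  unit_lower L -> is_infmx_diag D -> (i < N)%N ->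
  infmx_mul (infmx_mul L D) (infmx_tr L) i j =
  \sum_(k < N) L i k * D k k * L j k.
Proof.
move=> [_ L0] D0 iN.
have LD k : infmx_mul L D i k = L i k * D k k.
  (* The bound exceeds [i], so that [L i l] vanishes beyond it, and [k], so that the only surviving
     index [l = k] lies in range. *)
  rewrite /infmx_mul (@sum_nat_support _ (maxn i k).+1).
    have km : (k < (maxn i k).+1)%N by rewrite ltnS leq_maxr.
    rewrite (bigD1 (Ordinal km))//= big1 ?addr0// => l lk.
    by rewrite D0 ?mulr0.
  by move=> l; rewrite gtn_max => /andP[il _]; rewrite L0 ?mul0r.
rewrite {1}/infmx_mul (@sum_nat_support _ N).
  by apply: eq_bigr => k _; rewrite LD.
by move=> k Nk; rewrite LD L0 ?mul0r// (leq_trans iN).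
Qed.

(** Strong induction on the column [j]: in the entries with [j <= i], the terms [k < j] agree and
    cancel, leaving [L i j * D j j]. Taking [i = j] identifies the pivots, and dividing by the
    nonzero pivot identifies the column. *)
Lemma LDL_unique (R : idomainType) (A L D L' D' : infmx R) :
  (forall j, D j j != 0) -> is_LDL A L D -> is_LDL A L' D' ->
  L' = L /\ D' = D.
Proof.
move=> Dn0 [uL dD AE] [uL' dD' AE'].
have E i j : (j <= i)%N ->
    \sum_(k < j.+1) L i k * D k k * L j k =
    \sum_(k < j.+1) L' i k * D' k k * L' j k.
  move=> ji.
  (* [LDL_entry] needs a cut-off above [i]; since [M j k = 0] for [k > j], the sum can stop at [j],
     which makes [k = j] its last term. *)
  have tail (M F : infmx R) : unit_lower M -> \sum_(k < i.+1) M i k * F k k * M j k =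
      \sum_(k < j.+1) M i k * F k k * M j k.
    move=> [_ M0]; rewrite [RHS](big_ord_widen i.+1 (fun k => M i k * F k k * M j k))//.
    rewrite [RHS]big_mkcond/=; apply: eq_bigr => k _.
    by case: ltnP => // jk; rewrite (M0 j)// mulr0.
  rewrite -!tail//.
  have H := @LDL_entry R L D i j i.+1 uL dD (ltnSn i).
  have H' := @LDL_entry R L' D' i j i.+1 uL' dD' (ltnSn i).
  by rewrite -H -H' -AE -AE'.
have col j : D' j j = D j j /\ forall i, L' i j = L i j.
  elim/ltn_ind: j => j IH.
  have E' i : (j <= i)%N -> L i j * D j j = L' i j * D' j j.
    move=> /E; rewrite !big_ord_recr/= uL.1 uL'.1 !mulr1.
    rewrite [X in X + _ = _](_ : _ = \sum_(k < j) L' i k * D' k k * L' j k).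
      by move/addrI.
    apply: eq_bigr => k _; have [-> Lk] := IH k (ltn_ord k).
    by rewrite !Lk.
  have DE : D' j j = D j j.
    by have := E' j (leqnn j); rewrite uL.1 uL'.1 !mul1r.
  split=> // i; have [ij|ji] := ltnP i j; first by rewrite uL.2// uL'.2.
  by have := E' _ ji; rewrite DE => /(mulIf (Dn0 j)).
split; apply/funext => i; apply/funext => j; first by have [] := col j.
by have [->|ij] := eqVneq i j; [have [] := col j|rewrite dD// dD'].
Qed.

(** * Expansion of a Hermite polynomial at an argument scaled by a square root of 1/2 *)

(** Differentiating the recursion gives [2 H + 2 X H' - H''] with [H = H_(n+1)]; by induction
    [H' = 2 (n+1) H_n], so the last two terms are [2 (n+1) (2 X H_n - H_n') = 2 (n+1) H]. *)
Lemma deriv_hermite (R : comNzRingType) n :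
  (hermite R n.+1)^`() = (2 * n.+1%:R) *: hermite R n.
Proof.
elim: n => [|n IH].
  by rewrite /= mulr1 derivB -polyC1 derivC deriv0 subr0 derivZ derivX mulr1.
rewrite [hermite R n.+2]/= derivB derivZ derivM derivX mul1r.
rewrite -/(hermite R n.+1) IH derivZ.
rewrite [hermite R n.+1]/= -!mul_polyC !polyCM !polyC_natr; ring.
Qed.

(** These are the coefficients of [H_n(rX)] in the Hermite basis, for [r^2 = 1/2], with the factor
    [r^n] left out so that they are rational. *)
Definition hermite_half_coef (R : unitRingType) (n j : nat) : R :=
  if (j <= n)%N && ~~ odd (n - j) then
    (-1) ^+ (n - j)./2 * (n`!%:R / ((n - j)./2`!%:R * j`!%:R))
  else 0.

Lemma hermite_half_coefE (R : unitRingType) k j :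
  hermite_half_coef R (k.*2 + j) j =
  (-1) ^+ k * ((k.*2 + j)`!%:R / (k`!%:R * j`!%:R)).
Proof. by rewrite /hermite_half_coef leq_addl addnK odd_double doubleK. Qed.

Lemma hermite_half_coef_gt (R : unitRingType) n j :
  (n < j)%N -> hermite_half_coef R n j = 0.
Proof. by rewrite /hermite_half_coef ltnNge => /negbTE ->. Qed.

Lemma hermite_half_coef_odd (R : unitRingType) n j :
  odd (n + j) -> hermite_half_coef R n j = 0.
Proof.
by rewrite /hermite_half_coef; case: leqP => //= jn; rewrite oddB// -oddD => ->.
Qed.

(** For [n+1 = 2k+j], both terms on the right are multiples of [(-1)^k n! / (k! j!)], by [j] and
    [2k], and these add up to [n+1]. Otherwise parity or range makes everything zero. *)
Lemma hermite_half_coefS (R : numFieldType) n j :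
  hermite_half_coef R n.+1 j =
  (if j is j'.+1 then hermite_half_coef R n j' else 0)
  - (2 * j.+1%:R) * hermite_half_coef R n j.+1.
Proof.
have [odd_nj|even_nj] := boolP (odd (n.+1 + j)).
  rewrite (hermite_half_coef_odd R _ _ odd_nj).
  rewrite (hermite_half_coef_odd R n) ?mulr0 ?subr0; last by lia.
  by case: j odd_nj => // j odd_nj; rewrite hermite_half_coef_odd//; lia.
have [nj|jn] := ltnP n.+1 j.
  rewrite (hermite_half_coef_gt R _ _ nj) (hermite_half_coef_gt R n) ?mulr0 ?subr0; last by lia.
  by case: j nj {even_nj} => // j nj; rewrite hermite_half_coef_gt.
have {even_nj jn} [k nE] : exists k, n.+1 = (k.*2 + j)%N.
  by exists (n.+1 - j)./2; lia.
have f0 m : m`!%:R != 0 :> R by rewrite pnatr_eq0 -lt0n fact_gt0.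
have s0' m : 1 + m%:R != 0 :> R by rewrite nat1r.
have mul2nR m : m.*2%:R = 2 * m%:R :> R by rewrite -mul2n natrM.
(* At [k = 0] the second term vanishes because its column is [n+2]; further down, [j = 0] is
   separate because the first term is absent. *)
case: k nE => [|k] nE.
  have jE : j = n.+1 by lia.
  subst j; rewrite [X in _ * X]hermite_half_coef_gt; last by lia.
  have := hermite_half_coefE R 0 n.+1; have := hermite_half_coefE R 0 n.
  rewrite double0 !add0n => -> ->; rewrite mulr0 subr0 fact0 expr0.
  by rewrite !mul1r !divff.
have nE1 : n = (k.*2 + j.+1)%N by lia.
rewrite nE hermite_half_coefE {2}nE1 hermite_half_coefE -nE -nE1.
case: j nE nE1 => [|j] nE nE1.
  rewrite exprS !factS !natrM fact0 (_ : n.+1%:R = 2 * k.+1%:R :> R).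
    by field; rewrite f0 s0'.
  by rewrite -natrM nE; congr _%:R; lia.
rewrite (_ : n = k.+1.*2 + j)%N; last by lia.
rewrite hermite_half_coefE (_ : (k.+1.*2 + j)%N = n); last by lia.
rewrite exprS !factS !natrM (_ : n.+1%:R = 2 * k.+1%:R + j.+1%:R :> R).
  by field; rewrite f0 f0 !s0' -?natrD ?pnatr_eq0.
by rewrite nE natrD mul2nR.
Qed.

(* With [2 r^2 = 1], the recursion of [hermite] makes [g_n = r^-n H_n(rX)]
   satisfy [g_{n+1} = 2 X g_n - 2 g_n'], and [2 X H_j - 2 H_j'] is
   [H_{j+1} - H_j' = H_{j+1} - 2 j H_{j-1}]. *)
Lemma hermite_half_expansion (R : numFieldType) (r : R) n :
  r ^+ 2 = 2^-1 ->
  hermite R n \Po (r *: 'X) =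
  r ^+ n *: \sum_(j < n.+1) hermite_half_coef R n j *: hermite R j.
Proof.
move=> r2; have rr2 : 2 * r * r = 1 by rewrite -mulrA -expr2 r2 divff.
elim: n => [|n IH].
  rewrite expr0 scale1r big_ord_recl big_ord0 addr0 /hermite_half_coef/= fact0.
  by rewrite !mulr1 !mul1r invr1 scale1r -polyC1 comp_polyC.
set h := hermite_half_coef R in IH *.
set S := \sum_(j < n.+1) h n j *: hermite R j in IH.
have step : \sum_(j < n.+2) h n.+1 j *: hermite R j = 2 *: ('X * S) - 2 *: S^`().
  pose up j : R := if j is j'.+1 then h n j' else 0.
  have -> : \sum_(j < n.+2) h n.+1 j *: hermite R j =
      \sum_(j < n.+2) (up j *: hermite R j - h n j.+1 *: (hermite R j.+1)^`()).
    apply: eq_bigr => j _; rewrite /h hermite_half_coefS scalerBl deriv_hermite.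
    by rewrite scalerA [_ * (2 * _)]mulrC.
  rewrite sumrB big_ord_recl/= scale0r add0r.
  have -> : \sum_(j < n.+2) h n j.+1 *: (hermite R j.+1)^`() = S^`().
    (* Index shift: the term [j = 0] is the derivative of a constant, and the two top coefficients,
       at [n+1] and [n+2], are zero. *)
    have : \sum_(j < n.+3) h n j *: (hermite R j)^`() = _ := big_ord_recl _ _.
    rewrite /= -polyC1 derivC scaler0 add0r => <-.
    rewrite 2!big_ord_recr/= /h !(hermite_half_coef_gt R n) ?scale0r ?addr0//.
    by rewrite /S raddf_sum; apply: eq_bigr => j _; rewrite /= derivZ.
  rewrite (scaler_nat 2 S^`()) mulr2n opprD addrA; congr (_ - _).
  rewrite mulr_sumr scaler_sumr raddf_sum -sumrB; apply: eq_bigr => j _.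
  by rewrite /= add0n derivZ scalerBr -scalerAr !scalerA [2 * _]mulrC.
(* The chain rule brings out a factor [r], whose inverse is [2 r]. *)
have dcomp : (hermite R n)^`() \Po (r *: 'X) =
    (2 * r) *: (hermite R n \Po (r *: 'X))^`().
  by rewrite deriv_comp derivZ derivX -scalerAr mulr1 scalerA rr2 scale1r.
rewrite step [hermite R n.+1]/= comp_polyB comp_polyZ comp_polyM comp_polyX dcomp IH.
rewrite derivZ exprS -!mul_polyC.
by rewrite !polyCM; ring.
Qed.

(** * Change of scale, integrability and Parseval for the Gaussian weight *)

(** The substitution rule is applied to nonnegative functions, hence separately to the positive and
    negative parts; [max] commutes with multiplication by [s > 0]. *)
Lemma Rintegral_scale (R : realType) (s : R) (f : R -> R) :
  0 < s -> continuous f ->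
  (\int[lebesgue_measure]_x f x)%R =
  (\int[lebesgue_measure]_x (f (s * x) * s))%R.
Proof.
move=> s0 cf; congr fine.
have ds (x : R) : is_derive x (1 : R) ( *%R s) s.
  by apply: trigger_derive; rewrite /GRing.scale/= mulr1.
have Ds : (( *%R s)^`() = cst s)%classic.
  by apply/funext => x; rewrite derive1E derive_val.
have ge0 (g : R -> R) : continuous g -> (forall x, 0 <= g x) ->
    (\int[lebesgue_measure]_x (g x)%:E =
     \int[lebesgue_measure]_x (g (s * x) * s)%:E)%E.
  move=> cg g0.
  rewrite (@increasing_ge0_integration_by_substitutionT R ( *%R s) g)//.
  - by rewrite Ds.
  - by move=> x y xy; rewrite ltr_pM2l.
  - by rewrite Ds => x; exact: cst_continuous.
  - by rewrite Ds; exact: is_cvg_cst.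
  - by rewrite Ds; exact: is_cvg_cst.
  - exact: gt0_cvgMrNy.
  - exact: gt0_cvgMry.
have pos (g : R -> R) : continuous g ->
    (\int[lebesgue_measure]_x (Num.max (g x) 0)%:E =
     \int[lebesgue_measure]_x (Num.max (g (s * x) * s) 0)%:E)%E.
  move=> cg; rewrite (ge0 (fun x => Num.max (g x) 0)).
  - by apply: eq_integral => x _; rewrite maxr_pMl ?mul0r ?(ltW s0).
  - by move=> x; apply: continuous_max; [exact: cg|exact: cst_continuous].
  - by move=> x; rewrite le_max lexx orbT.
rewrite integralE [RHS]integralE !funerpos !funerneg.
congr (_ - _)%E; first exact: pos.
rewrite (pos (fun x => - f x)).
  by apply: eq_integral => x _; rewrite /= mulNr.
by move=> x; apply: cvgN; exact: cf.
Qed.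

(** The squares are integrable because orthogonality gives their integral a positive value; mixed
    products follow from [|ab| <= a^2 + b^2]. *)
Lemma integrable_hermite (R : realType) n m :
  (@lebesgue_measure R).-integrable setT
    (fun v => ((hermite R n).[v] * (hermite R m).[v] * expR (- v ^+ 2))%:E).
Proof.
have mh i j : measurable_fun setT
    (fun v : R => (hermite R i).[v] * (hermite R j).[v] * expR (- v ^+ 2)).
  apply: continuous_measurable_fun => x.
  apply: cvgM; last exact: continuous_gauss_fun.
  by apply: cvgM; exact: continuous_horner.
have sq k : (@lebesgue_measure R).-integrable setT
    (fun v => ((hermite R k).[v] * (hermite R k).[v] * expR (- v ^+ 2))%:E).
  have f0 (v : R) : 0 <= (hermite R k).[v] * (hermite R k).[v] * expR (- v ^+ 2).
    by rewrite mulr_ge0 ?expR_ge0// -expr2 sqr_ge0.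
  apply/integrableP; split; first by apply/measurable_EFinP; exact: mh.
  under eq_integral do rewrite gee0_abs ?lee_fin//.
  have := hermite_orthogonal R k k; rewrite eqxx /Rintegral.
  set I := (\int[_]_(x in _) _)%E.
  rewrite ltey; case: eqP => // -> /= E.
  (* [fine] of an infinite integral is 0, but the square norm is positive. *)
  suff : 0 < Num.sqrt pi * 2 ^+ k * k`!%:R :> R by rewrite -E ltxx.
  by rewrite !mulr_gt0 ?sqrtr_gt0 ?pi_gt0 ?exprn_gt0 ?ltr0n ?fact_gt0.
have := integrableD measurableT (sq n) (sq m).
apply: le_integrable => //; first by apply/measurable_EFinP; exact: mh.
move=> x _; rewrite /= lee_fin.
set a := (hermite R n).[x]; set b := (hermite R m).[x].
rewrite -mulrDl !normrM; apply: ler_wpM2r => //.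
rewrite -normrM [leRHS]ger0_norm ?addr_ge0 -?expr2 ?sqr_ge0// ler_norml.
by nra.
Qed.

(** Parseval's identity for finite Hermite sums: the product expands over pairs of indices, and
    orthogonality keeps the diagonal. *)
Lemma Rintegral_hermite_sum (R : realType) (a b : nat -> R) N :
  (\int[lebesgue_measure]_v
     ((\sum_(j < N) a j *: hermite R j).[v] * (\sum_(j < N) b j *: hermite R j).[v]
      * expR (- v ^+ 2)))%R =
  \sum_(j < N) a j * b j * (Num.sqrt pi * 2 ^+ j * j`!%:R).
Proof.
pose w i j (v : R) := (hermite R i).[v] * (hermite R j).[v] * expR (- v ^+ 2).
have iw i j : (@lebesgue_measure R).-integrable setT (EFin \o w i j).
  exact: integrable_hermite.
rewrite /Rintegral.
have -> : (\int[lebesgue_measure]_v ((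
    (\sum_(j < N) a j *: hermite R j).[v] * (\sum_(j < N) b j *: hermite R j).[v]
      * expR (- v ^+ 2))%:E) = \int[lebesgue_measure]_v
    (\sum_(p : 'I_N * 'I_N) (a p.1 * b p.2)%:E * (w p.1 p.2 v)%:E))%E.
  apply: eq_integral => v _.
  transitivity (\sum_(i < N) \sum_(j < N) a i * b j * w i j v)%:E; last first.
    by rewrite pair_bigA -sumEFin.
  congr EFin; rewrite !horner_sum !mulr_suml; apply: eq_bigr => i _.
  rewrite mulr_sumr mulr_suml; apply: eq_bigr => j _.
  by rewrite !hornerZ /w; ring.
rewrite integral_sum//; last by move=> p; apply: integrableZl; last exact: iw.
rewrite -sum_fine; last first.
  by move=> p _; apply: integrable_fin_num => //; apply: integrableZl; last exact: iw.
rewrite -(pair_bigA _ (fun i j : 'I_N => fine (\int[lebesgue_measure]_v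
    ((a i * b j)%:E * (w i j v)%:E))%E))/=; apply: eq_bigr => i _.
have E (j : 'I_N) : fine (\int[lebesgue_measure]_v
    ((a i * b j)%:E * (w i j v)%:E))%E =
    if i == j then a i * b j * (Num.sqrt pi * 2 ^+ j * j`!%:R) else 0.
  rewrite integralZl//; last exact: iw.
  rewrite fineM//; last by apply: integrable_fin_num; last exact: iw.
  have -> : fine (\int[lebesgue_measure]_v (w i j v)%:E)%E = _ :=
    hermite_orthogonal R i j.
  by rewrite (inj_eq val_inj); case: eqVneq => // _; rewrite mulr0.
under eq_bigr do rewrite E.
by rewrite -big_mkcond/= (big_pred1 i)// => j; rewrite eq_sym.
Qed.

(** * Matching the Gram entries with the Cholesky factors *)

(** With [n = 2k+j], [4^-k] is [2^(j-n)], and [sqrt (n!/j!)] is [n!/j!] times [sqrt (j!/n!)]. *)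
Lemma chol_LE (R : realType) n j :
  chol_L R n j = hermite_half_coef R n j *
    (Num.sqrt j`!%:R / Num.sqrt n`!%:R) * (2 ^+ j / 2 ^+ n).
Proof.
rewrite /chol_L /hermite_half_coef; case: ifP; last by rewrite !mul0r.
move=> /andP[jn even_nj].
set k := (n - j)./2.
have nE : n = (k.*2 + j)%N by rewrite /k; lia.
have -> : 2 ^+ n = 4 ^+ k * 2 ^+ j :> R.
  by rewrite nE exprD -mul2n exprM -natrX.
have fE i : i`!%:R = Num.sqrt i`!%:R ^+ 2 :> R by rewrite sqr_sqrtr ?ler0n.
have f0 i : Num.sqrt i`!%:R != 0 :> R.
  by rewrite gt_eqF// sqrtr_gt0 ltr0n fact_gt0.
rewrite sqrtrM ?ler0n// sqrtrV ?ler0n// (fE n) (fE j).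
rewrite !sqrtr_sqr !ger0_norm ?sqrtr_ge0//.
field; rewrite !f0 !expf_neq0 ?pnatr_eq0 -?lt0n ?fact_gt0//.
Qed.

Lemma chol_DE (R : realType) j :
  chol_D R j j = (2 ^+ j * Num.sqrt 2)^-1.
Proof.
rewrite /chol_D /infmx_diag eqxx -opprD powRN powRD ?pnatr_eq0 ?implybT//.
by rewrite powR_mulrn// powR12_sqrt.
Qed.

(** Coefficient of [H_j(u)] in [e^(u^2/2) psi_n(sqrt (T/2) u)]: the first factor normalises [psi],
    the second is [r^n] for [r = 1 / sqrt 2]. *)
Definition psi_half_coef (R : realType) (T : R) (n j : nat) : R :=
  (Num.sqrt 2 ^+ n * Num.sqrt n`!%:R * Num.sqrt (Num.sqrt (pi * T)))^-1
  * Num.sqrt 2 ^- n * hermite_half_coef R n j.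

(** This scale turns [v^2 / T] into [u^2 / 2], so a product of two such functions carries the weight
    [e^(-u^2)]. Zero coefficients pad the sum up to [N], giving different [n] a common range. *)
Lemma psi_scale (R : realType) (T : R) n N (u : R) :
  0 < T -> (n < N)%N ->
  psi T n (Num.sqrt (T / 2) * u) =
  (\sum_(j < N) psi_half_coef R T n j *: hermite R j).[u] * expR (- (u ^+ 2 / 2)).
Proof.
move=> T0 nN; set t : R := Num.sqrt 2.
have t2 : t ^+ 2 = 2 by rewrite sqr_sqrtr.
have t0 : t != 0 by rewrite gt_eqF// sqrtr_gt0.
have rE : Num.sqrt (T / 2) = Num.sqrt T * t^-1.
  by rewrite sqrtrM ?(ltW T0)// sqrtrV.
have sT0 : Num.sqrt T != 0 by rewrite gt_eqF// sqrtr_gt0.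
rewrite /psi; congr (_ * expR _); last first.
  rewrite exprMn sqr_sqrtr ?divr_ge0 ?(ltW T0)//; field; exact: lt0r_neq0.
have -> : Num.sqrt (T / 2) * u / Num.sqrt T = t^-1 * u.
  by rewrite rE; field; rewrite ?sT0 ?t0.
rewrite powRN powR12_sqrt; last by rewrite !mulr_ge0 ?sqrtr_ge0 ?exprn_ge0.
rewrite sqrtrM ?mulr_ge0 ?exprn_ge0// sqrtrM ?exprn_ge0//.
have -> : Num.sqrt (2 ^+ n) = t ^+ n :> R.
  by rewrite -t2 -exprM mulnC exprM sqrtr_sqr ger0_norm// exprn_ge0// sqrtr_ge0.
have -> : (hermite R n).[t^-1 * u] = (hermite R n \Po (t^-1 *: 'X)).[u].
  by rewrite horner_comp hornerZ hornerX.
rewrite hermite_half_expansion ?exprVn ?t2// -hornerZ scalerA scaler_sumr.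
congr (_.[_]).
rewrite (big_ord_widen N (fun j => _ *: (hermite_half_coef R n j *: hermite R j)))//.
rewrite big_mkcond/=; apply: eq_bigr => j _; rewrite ltnS scalerA.
by case: leqP => // nj; rewrite /psi_half_coef hermite_half_coef_gt// mulr0 scale0r.
Qed.

Lemma continuous_psi (R : realType) (T : R) n : continuous (psi T n).
Proof.
have cH : continuous (fun v : R => (hermite R n).[v / Num.sqrt T]).
  move=> v; apply: (@continuous_comp R R R (fun v => v / Num.sqrt T)).
    by apply: cvgM; [exact: cvg_id|exact: cvg_cst].
  exact: continuous_horner.
have cE : continuous (fun v : R => expR (- v ^+ 2 / T)).
  move=> v; apply: (@continuous_comp R R R (fun v => - v ^+ 2 / T)).
    by apply: cvgM; [apply: cvgN; exact: exprn_continuous|exact: cvg_cst].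
  exact: continuous_expR.
move=> v; apply: cvgM; last exact: cE.
by apply: cvgM; [exact: cvg_cst|exact: cH].
Qed.

(** [T] and [pi] cancel: [sqrt (T/2) * sqrt pi / sqrt (pi T) = 1 / sqrt 2], the constant in
    [chol_D]. *)
Lemma gram_psi (R : realType) (T : R) m n N :
  0 < T -> (m < N)%N -> (n < N)%N ->
  gram (psi T) m n = \sum_(j < N) chol_L R m j * chol_D R j j * chol_L R n j.
Proof.
move=> T0 mN nN; rewrite /gram (@Rintegral_scale R (Num.sqrt (T / 2))).
(* The Jacobian [sqrt (T/2)] is absorbed into the coefficients of the first factor, so that Parseval
   applies. *)
- transitivity ((\int[lebesgue_measure]_u
      ((\sum_(j < N) (psi_half_coef R T m j * Num.sqrt (T / 2)) *: hermite R j).[u] *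
       (\sum_(j < N) psi_half_coef R T n j *: hermite R j).[u] * expR (- u ^+ 2)))%R).
    apply: eq_Rintegral => u _; rewrite (psi_scale R T m N)// (psi_scale R T n N)//.
    rewrite [in RHS](_ : - u ^+ 2 = - (u ^+ 2 / 2) - (u ^+ 2 / 2)); last by field.
    rewrite expRD.
    under [in RHS]eq_bigr do rewrite mulrC -scalerA.
    rewrite -scaler_sumr hornerZ; ring.
  rewrite (Rintegral_hermite_sum R
    (fun j => psi_half_coef R T m j * Num.sqrt (T / 2)) (psi_half_coef R T n)).
  apply: eq_bigr => j _.
  rewrite !chol_LE chol_DE /psi_half_coef.
  set t : R := Num.sqrt 2; set q : R := Num.sqrt (Num.sqrt (pi * T)).
  have t2 : t ^+ 2 = 2 by rewrite sqr_sqrtr.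
  have t0 : t != 0 by rewrite gt_eqF// sqrtr_gt0.
  rewrite sqrtrM ?(ltW T0)// sqrtrV// -/t.
  have sT0 : Num.sqrt T != 0 by rewrite gt_eqF// sqrtr_gt0.
  have q0 : q != 0 by rewrite gt_eqF// !sqrtr_gt0 mulr_gt0 ?pi_gt0.
  have f0 i : Num.sqrt i`!%:R != 0 :> R by rewrite gt_eqF// sqrtr_gt0 ltr0n fact_gt0.
  (* Everything is expressed through [t], [q], [sqrt T] and roots of factorials, which leaves a
     rational identity for [field]. *)
  have -> : Num.sqrt pi = q ^+ 2 / Num.sqrt T :> R.
    by rewrite sqr_sqrtr ?sqrtr_ge0// sqrtrM ?pi_ge0// mulfK.
  have -> : j`!%:R = Num.sqrt j`!%:R ^+ 2 :> R by rewrite sqr_sqrtr ?ler0n.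
  rewrite !sqrtr_sqr !ger0_norm ?sqrtr_ge0//.
  have pow2 k : 2 ^+ k = (t ^+ k) ^+ 2 :> R by rewrite -exprM mulnC exprM t2.
  rewrite !pow2.
  by field; rewrite ?q0 ?sT0 ?f0 ?t0 ?expf_neq0.
- by rewrite sqrtr_gt0 divr_gt0.
- by move=> v; apply: cvgM; exact: continuous_psi.
Qed.

Theorem proposition3p5 (R : realType) (T : R) (T_gt0 : 0 < T) :
  is_LDL (gram (psi T)) (chol_L R) (chol_D R) /\
  (forall L D : infmx R, is_LDL (gram (psi T)) L D ->
     L = chol_L R /\ D = chol_D R).
Proof.
have LDL : is_LDL (gram (psi T)) (chol_L R) (chol_D R).
  have uL : unit_lower (chol_L R).
    split=> [i|i j ij]; rewrite /chol_L; last by rewrite leqNgt ij.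
    rewrite leqnn subnn/= !expr0 divff ?pnatr_eq0 -?lt0n ?fact_gt0//.
    by rewrite sqrtr1 fact0 !mulr1 !mul1r invr1.
  have dD : is_infmx_diag (chol_D R).
    by move=> i j; rewrite /chol_D /infmx_diag => /negbTE ->.
  split=> //; apply/funext => m; apply/funext => n.
  (* [LDL_entry] asks the cut-off to exceed [m], [gram_psi] to exceed both indices. *)
  rewrite (@LDL_entry R _ _ m n (maxn m n).+1)// ?ltnS ?leq_maxl//.
  by apply: gram_psi => //; rewrite ltnS ?leq_maxl ?leq_maxr.
split=> // L D; apply: LDL_unique LDL => j.
by rewrite chol_DE invr_neq0// mulf_neq0 ?expf_neq0 ?pnatr_eq0// gt_eqF ?sqrtr_gt0.
Qed.
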